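(* Let $G$ be a graph and let $e\in E(G)$. Then $$|\gamma_g(G)-\gamma_g(G-e)|\le 2\qquad\text{and}\qquad |\gamma_g'(G)-\gamma_g'(G-e)|\le 2.$$
   Context: Graphs are finite, simple and undirected. A vertex dominates itself and all its neighbors. The domination game on a graph $G$ is played by two players, Dominator and Staller, who alternately choose a vertex of $G$ such that each chosen vertex dominates at least one vertex that was not dominated by the previously chosen vertices. The game ends when all vertices of $G$ are dominated. Dominator wants the total number of chosen vertices to be as small as possible, Staller wants it to be as large as possible. In Game 1 Dominator moves first; in Game 2 Staller moves first. Assuming both play optimally, $\gamma_g(G)$ (the game domination number) is the total number of vertices chosen in Game 1, and $\gamma_g'(G)$ (the Staller-start game domination number) is the total number of vertices chosen in Game 2. $G-e$ denotes the graph obtained from $G$ by removing the edge $e$ (keeping all vertices). *)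

(* Defs.v *)
From mathcomp Require Import all_boot.

Set Implicit Arguments.
Unset Strict Implicit.
Unset Printing Implicit Defensive.

Record sgraph := SGraph {
  vertex :> finType;
  adj : rel vertex;
  adj_sym : symmetric adj;
  adj_irrefl : irreflexive adj }.

Definition edges (G : sgraph) : {set {set G}} :=
  [set [set p.1; p.2] | p : G * G & adj p.1 p.2].

Section DeleteEdge.
Variables (G : sgraph) (e : {set G}).

Definition del_edge_rel : rel G := fun x y => adj x y && ([set x; y] != e).

Lemma del_edge_sym : symmetric del_edge_rel.
Proof. by move=> x y; rewrite /del_edge_rel adj_sym setUC. Qed.

Lemma del_edge_irrefl : irreflexive del_edge_rel.
Proof. by move=> x; rewrite /del_edge_rel adj_irrefl. Qed.

Definition del_edge : sgraph := SGraph del_edge_sym del_edge_irrefl.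
End DeleteEdge.

Lemma edges_del_edge (G : sgraph) (e : {set G}) :
  edges (del_edge e) = edges G :\ e.
Proof.
apply/setP=> f; rewrite in_setD1; apply/imsetP/andP.
  case=> -[x y]; rewrite inE /= => /andP[xy ne] ->; split=> //.
  by apply/imsetP; exists (x, y); rewrite ?inE.
case=> ne /imsetP[[x y]]; rewrite inE /= => xy def_f.
by exists (x, y); rewrite // inE /= /del_edge_rel xy -def_f.
Qed.

Section DominationGame.
Variable G : sgraph.
Implicit Types (D : {set G}) (v : G).

Definition closed_nbhd v : {set G} := [set w | (w == v) || adj v w].

(* A position of the game is the set D of vertices dominated so far. *)
Definition legal D v : bool := ~~ (closed_nbhd v \subset D).

Inductive player := Dominator | Staller.

(* Minimax value, cut off after n moves.  The default n of the minimum is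
   never smaller than 1 plus the value after a move, so it has no effect when
   there is a legal move. *)
Fixpoint bounded_value (n : nat) (p : player) D : nat :=
  if n isn't m.+1 then 0 else
  if D == setT then 0 else
  match p with
  | Dominator => \big[minn/n]_(v | legal D v)
                   (bounded_value m Staller (D :|: closed_nbhd v)).+1
  | Staller => \max_(v | legal D v)
                   (bounded_value m Dominator (D :|: closed_nbhd v)).+1
  end.

(* A legal move dominates a new vertex, so at most #|~: D| moves remain and
   the cut-off is never reached before the end of the game. *)
Definition game_value (p : player) D : nat := bounded_value #|~: D| p D.

Definition game_dom : nat := game_value Dominator set0.
Definition staller_game_dom : nat := game_value Staller set0.

Lemma bounded_value_le n p D : bounded_value n p D <= n.
Proof.
elim: n p D => [|n IHn] p D //=; case: eqP => // _; case: p.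
  elim/big_rec: _ => // v k _ le_k; by rewrite geq_min ltnS IHn.
by apply/bigmax_leqP=> v _; rewrite ltnS IHn.
Qed.

Lemma legal_decr D v : legal D v -> #|~: (D :|: closed_nbhd v)| < #|~: D|.
Proof.
move=> Dv; apply: proper_card; rewrite setCU properE subsetIl /=.
apply: contra Dv => /subsetP sub; apply/subsetP=> w wv.
by apply: contraLR wv => wD; move: (sub w); rewrite !inE wD => /(_ isT).
Qed.

Lemma exists_legal D : D != setT -> exists v, legal D v.
Proof.
rewrite -subTset => /subsetPn[v _ vD]; exists v.
by apply/subsetPn; exists v => //; rewrite inE eqxx.
Qed.

Lemma big_minn_idx (I : finType) (P : pred I) (F : I -> nat) n m :
    (forall i, P i -> F i <= n) -> (forall i, P i -> F i <= m) ->
    (exists i, P i) ->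
  \big[minn/n]_(i | P i) F i = \big[minn/m]_(i | P i) F i.
Proof.
move=> leFn leFm [i Pi].
have E k : (forall i, P i -> F i <= k) ->
    \big[minn/k]_(i | P i) F i = F [arg min_(j < i | P j) F j].
  move=> leF; case: arg_minnP => // j Pj minj; apply/eqP.
  rewrite eqn_leq; apply/andP; split; last first.
    by elim/big_rec: _ => [|l x Pl lex]; rewrite ?leF // leq_min minj.
  have: j \in index_enum I by rewrite mem_index_enum.
  elim: (index_enum I) => //= l s IHs; rewrite inE big_cons.
  case/predU1P=> [<-|/IHs le_s]; first by rewrite Pj geq_minl.
  by case: (P l); rewrite // geq_min le_s orbT.
by rewrite !E.
Qed.

Lemma bounded_value_stable n m p D :
  #|~: D| <= n -> #|~: D| <= m -> bounded_value n p D = bounded_value m p D.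
Proof.
elim: n m p D => [|n IHn] [|m] p D //=.
- by rewrite leqn0 cards_eq0 -setCT (inj_eq (@setC_inj _)) => /eqP->; rewrite eqxx.
- by rewrite leqn0 cards_eq0 -setCT (inj_eq (@setC_inj _)) => _ /eqP->; rewrite eqxx.
move=> le_n le_m; case: eqP => // /eqP nD.
have E q v : legal D v -> bounded_value n q (D :|: closed_nbhd v) =
                          bounded_value m q (D :|: closed_nbhd v).
  by move=> /legal_decr lt; apply: IHn; rewrite -ltnS; apply: leq_trans lt _.
case: p; last by apply: eq_bigr => v /E->.
rewrite (eq_bigr _ (fun v Dv => congr1 S (E Staller v Dv))).
apply: big_minn_idx => [v Dv|v _|]; last exact: exists_legal.
  by rewrite -(E Staller v Dv) ltnS bounded_value_le.
by rewrite ltnS bounded_value_le.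
Qed.

Lemma game_value_setT p : game_value p setT = 0.
Proof. by rewrite /game_value setCT cards0. Qed.

Lemma game_value_Staller D : D != setT ->
  game_value Staller D =
  \max_(v | legal D v) (game_value Dominator (D :|: closed_nbhd v)).+1.
Proof.
move=> nD; rewrite {1}/game_value.
case Dn: #|~: D| => [|n] /=.
  by move/eqP: Dn; rewrite cards_eq0 -setCT (inj_eq (@setC_inj _)) (negPf nD).
rewrite (negPf nD); apply: eq_bigr => v Dv; congr S.
by apply: bounded_value_stable; rewrite // -ltnS -Dn legal_decr.
Qed.

Lemma game_value_Dominator_le D v : legal D v ->
  game_value Dominator D <= (game_value Staller (D :|: closed_nbhd v)).+1.
Proof.
move=> Dv; have lt := legal_decr Dv; rewrite {1}/game_value.
case Dn: #|~: D| lt => [|n] //= le_n; case: eqP => // _.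
rewrite /game_value (bounded_value_stable Staller (leqnn _) le_n).
have: v \in index_enum G by rewrite mem_index_enum.
elim: (index_enum G) => //= w s IHs; rewrite inE big_cons.
case/predU1P=> [<-|/IHs le_s]; first by rewrite Dv geq_minl.
by case: (legal D w); rewrite // geq_min le_s orbT.
Qed.

Lemma game_value_Dominator_attained D : D != setT ->
  exists2 v, legal D v &
    game_value Dominator D = (game_value Staller (D :|: closed_nbhd v)).+1.
Proof.
move=> nD; have [v0 Dv0] := exists_legal nD.
have [v Dv minv] :=
  arg_minnP (fun v => (game_value Staller (D :|: closed_nbhd v)).+1) Dv0.
exists v => //; apply/eqP; rewrite eqn_leq game_value_Dominator_le //=.
rewrite [leqRHS]/game_value; have lt0 := legal_decr Dv.
case Dn: #|~: D| lt0 => [|n] //= le_v; rewrite (negPf nD).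
elim/big_rec: _ => [|w k Dw le_k].
  by rewrite ltnS /game_value (leq_trans (bounded_value_le _ _ _)) // -ltnS.
rewrite leq_min le_k andbT (leq_trans (minv w Dw)) // ltnS /game_value.
by rewrite (bounded_value_stable _ (m := n)) // -ltnS -Dn legal_decr.
Qed.

End DominationGame.

(* Main.v *)
(** Every inequality is proved by letting Dominator follow an optimal strategy
    of the other game.  Once both ends of [e] are dominated, the games on [G]
    and on [G - e] coincide.  From a common position, a Staller move of [G] that
    is illegal in [G - e] dominates both ends of [e], so the games coincide from
    then on at the cost of two extra moves.  Conversely, a move at an end of [e]
    dominates in [G] at most one vertex more than in [G - e], and
    predominating a single vertex shortens a game by at most two moves. *)
Require Import Defs.
From mathcomp Require Import all_boot all_order all_algebra.

Set Implicit Arguments.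
Unset Strict Implicit.
Unset Printing Implicit Defensive.

(** * Monotonicity and predomination on a single graph *)

Section Continuation.
Variable G : sgraph.
Implicit Types (D : {set G}) (v : G) (p : player).

(** Descent on the number of undominated vertices, which drops at every legal move. *)
Lemma position_ind (P : {set G} -> Prop) :
    (forall D, (forall D', D \proper D' -> P D') -> P D) ->
  forall D, P D.
Proof.
move=> IH D; have [n] := ubnP #|~: D|.
elim: n D => // n IHn D; rewrite ltnS => le_n; apply: IH => D' DD'; apply: IHn.
by apply: leq_trans le_n; rewrite proper_card // -properC !setCK.
Qed.

Lemma legal_proper D v : legal D v -> D \proper D :|: closed_nbhd v.
Proof. by move=> Dv; rewrite properE subsetUl subUset subxx. Qed.

Lemma game_value_Staller_ge D v : legal D v ->
  game_value Dominator (D :|: closed_nbhd v) < game_value Staller D.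
Proof.
move=> Dv; have nD : D != setT.
  by apply: contraTneq Dv => ->; rewrite /legal subsetT.
by rewrite (game_value_Staller nD) (leq_bigmax_cond _ Dv).
Qed.

Lemma game_value_Staller_leP D k :
    (forall v, legal D v ->
       game_value Dominator (D :|: closed_nbhd v) < k) ->
  game_value Staller D <= k.
Proof.
move=> lek; have [->|nD] := eqVneq D setT; first by rewrite game_value_setT.
by rewrite (game_value_Staller nD); apply/bigmax_leqP.
Qed.

(** Dominator copies on [B] his optimal move [v] on [A]. If [v] is illegal there, its closed
    neighborhood already lies in [B], and any legal move keeps the inclusion. Staller's legal moves
    on [B] are legal on [A]. *)
Lemma continuation_principle (A B : {set G}) p :
  A \subset B -> game_value p B <= game_value p A.
Proof.
elim/position_ind: A B p => A IH B [] sAB.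
  have [->|nB] := eqVneq B setT; first by rewrite game_value_setT.
  have nA : A != setT.
    by apply: contraNneq nB => A_T; rewrite -subTset -A_T.
  have [v Av ->] := game_value_Dominator_attained nA.
  have [u Bu sub_u] : exists2 u, legal B u &
      A :|: closed_nbhd v \subset B :|: closed_nbhd u.
    have [Bv|] := boolP (legal B v); first by exists v; rewrite // setSU.
    rewrite /legal negbK => sv; have [u Bu] := exists_legal nB.
    by exists u; rewrite // (subset_trans _ (subsetUl _ _)) // subUset sAB.
  apply: leq_trans (game_value_Dominator_le Bu) _.
  by rewrite ltnS IH ?legal_proper.
apply: game_value_Staller_leP => v Bv.
have Av : legal A v by apply: contra Bv => /subset_trans; apply.
apply: leq_ltn_trans (game_value_Staller_ge Av).
by rewrite IH ?legal_proper ?setSU.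
Qed.

(** Lets Dominator copy a move from another game without checking its legality. *)
Lemma game_value_Dominator_le_any D v :
  game_value Dominator D <= (game_value Staller (D :|: closed_nbhd v)).+1.
Proof.
have [|] := boolP (legal D v); first exact: game_value_Dominator_le.
rewrite /legal negbK => /setUidPl ->.
have [->|/exists_legal[u Du]] := eqVneq D setT; first by rewrite game_value_setT.
apply: leq_trans (game_value_Dominator_le Du) _.
by rewrite ltnS continuation_principle ?subsetUl.
Qed.

(** The price of handing the turn to Dominator: one arbitrary legal move. *)
Lemma game_value_Dominator_leS D :
  game_value Dominator D <= (game_value Staller D).+1.
Proof.
have [->|/exists_legal[u Du]] := eqVneq D setT; first by rewrite game_value_setT.
apply: leq_trans (game_value_Dominator_le Du) _.
by rewrite ltnS continuation_principle ?subsetUl.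
Qed.

Lemma game_value_predominate p D y :
  game_value p D <= (game_value p (y |: D)).+2.
Proof.
elim/position_ind: D p => D IH [].
  (* The copied game may already be over; then playing [y] ends the real one. *)
  have [yD_T|nyD] := eqVneq (y |: D) setT.
    apply: leq_trans (game_value_Dominator_le_any D y) _; rewrite !ltnS.
    suff -> : D :|: closed_nbhd y = setT by rewrite game_value_setT.
    apply/eqP; rewrite -subTset -yD_T subUset subsetUl andbT sub1set.
    by rewrite !inE eqxx orbT.
  have [v yDv ->] := game_value_Dominator_attained nyD.
  have Dv : legal D v.
    by apply: contra yDv => /subset_trans; apply; apply: subsetUr.
  apply: leq_trans (game_value_Dominator_le Dv) _.
  by rewrite ltnS -setUA IH ?legal_proper.
apply: game_value_Staller_leP => v Dv.
have [yDv|] := boolP (legal (y |: D) v).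
  apply: leq_ltn_trans (IH _ (legal_proper Dv) _) _; rewrite !ltnS setUA.
  exact: game_value_Staller_ge.
rewrite /legal negbK => sub_v.
(* Such a Staller move dominates [y], so the two positions merge. The two extra moves are this one
   and the one paid for the change of turn. *)
rewrite ltnS; apply: leq_trans (game_value_Dominator_leS _).
apply: continuation_principle.
have yv : y \in closed_nbhd v.
  apply: contraNT Dv => y'v; apply/subsetP=> w wv.
  have /setU1P[wy|//] := subsetP sub_v w wv.
  by rewrite wy (negPf y'v) in wv.
by rewrite subUset sub1set inE yv orbT subsetUl.
Qed.

End Continuation.

(** * Comparison of the games on [G] and on [H] *)

Section EdgeRemoval.
Variables (G : sgraph) (e : {set G}).
Implicit Types (D : {set G}) (v : G) (p : player).
Let H := del_edge e.

Lemma closed_nbhd_del_edge_sub v :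
  (@closed_nbhd H v : {set G}) \subset @closed_nbhd G v.
Proof.
apply/subsetP=> w; rewrite !inE => /orP[->//|/andP[-> _]].
exact: orbT.
Qed.

Lemma closed_nbhd_del_edge v :
  @closed_nbhd G v = @closed_nbhd H v \/
  exists2 y, e = [set v; y] & @closed_nbhd G v = y |: @closed_nbhd H v.
Proof.
have [sub|] := boolP (@closed_nbhd G v \subset (@closed_nbhd H v : {set G})).
  by left; apply/eqP; rewrite eqEsubset sub closed_nbhd_del_edge_sub.
case/subsetPn=> y yG; rewrite inE negb_or /= /del_edge_rel => /andP[yv].
move: (yG); rewrite inE (negPf yv) /= => vy; rewrite vy negbK => /eqP def_e.
right; exists y => //; apply/eqP; rewrite eqEsubset; apply/andP; split; last first.
  by rewrite subUset sub1set yG closed_nbhd_del_edge_sub.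
apply/subsetP=> w; rewrite !inE /= /del_edge_rel => /orP[->|vw].
  by rewrite orbT.
rewrite vw -def_e /=; have [//|wy] := eqVneq w y; do 2![apply/orP; right].
(* If [vw] were the deleted edge [vy] with [w] different from [y], then [w] would be [v], a loop. *)
apply/eqP=> /setP/(_ w); rewrite !inE eqxx orbT (negPf wy) orbF => /esym/eqP wv.
by rewrite wv adj_irrefl in vw.
Qed.

Lemma closed_nbhdU_del_edge D v : e \subset D ->
  D :|: @closed_nbhd H v = D :|: @closed_nbhd G v.
Proof.
move=> eD; have [->//|[y def_e ->]] := closed_nbhd_del_edge v.
rewrite setUCA; symmetry; apply/setUidPr; rewrite sub1set inE.
by rewrite (subsetP eD) // def_e !inE eqxx orbT.
Qed.

Lemma legal_del_edge D v : e \subset D -> @legal H D v = @legal G D v.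
Proof.
move=> eD; have eqU := closed_nbhdU_del_edge v eD; congr (~~ _).
by apply/setUidPl/setUidPl; rewrite eqU.
Qed.

Lemma game_value_del_edge p D : e \subset D ->
  @game_value H p D = @game_value G p D.
Proof.
(* The cut-off, the same number for both graphs, is detached from [D] so that the induction follows
   the recursion of [bounded_value]. *)
rewrite /game_value; move: #|_| => n.
elim: n p D => // n IHn p D eD /=; case: (D == setT) => //.
have E q v : @bounded_value H n q (D :|: @closed_nbhd H v) =
             @bounded_value G n q (D :|: @closed_nbhd G v).
  by rewrite closed_nbhdU_del_edge // IHn // subsetU ?eD.
by case: p; apply: eq_big => v => [|_]; rewrite ?legal_del_edge ?E.
Qed.

Lemma game_value_le_del_edge p D :
  @game_value G p D <= (@game_value H p D).+2.
Proof.
elim/position_ind: D p => D IH p.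
(* After the same move, the position in [G] contains the one in [H]; the continuation principle
   returns to a common position. *)
have step q v : @legal H D v ->
    @game_value G q (D :|: @closed_nbhd G v) <=
    (@game_value H q (D :|: @closed_nbhd H v)).+2.
  move=> Dv; apply: leq_trans (IH _ (@legal_proper H D v Dv) q).
  by rewrite continuation_principle // setUS // closed_nbhd_del_edge_sub.
case: p.
  have [->|nD] := eqVneq D setT; first by rewrite game_value_setT.
  have [v Dv ->] := @game_value_Dominator_attained H D nD.
  by apply: leq_trans (game_value_Dominator_le_any D v) _; rewrite ltnS step.
apply: game_value_Staller_leP => v Dv; have [Dv'|] := boolP (@legal H D v).
  apply: leq_ltn_trans (step _ _ Dv') _; rewrite !ltnS.
  exact: (@game_value_Staller_ge H D v Dv').
rewrite /legal negbK => sub_v.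
have [eqN|[y def_e eqN]] := closed_nbhd_del_edge v.
  by rewrite /legal eqN sub_v in Dv.
have eD : e \subset D :|: @closed_nbhd G v.
  by rewrite def_e subUset !sub1set eqN !inE !eqxx !orbT.
(* One extra move is [v] itself, the other pays for the change of turn. *)
rewrite ltnS -game_value_del_edge //.
apply: leq_trans (@game_value_Dominator_leS H D).
exact: (@continuation_principle H D _ Dominator (subsetUl _ _)).
Qed.

Lemma game_value_del_edge_le p D :
  @game_value H p D <= (@game_value G p D).+2.
Proof.
elim/position_ind: D p => D IH p.
have step q v : @legal G D v ->
    @game_value H q (D :|: @closed_nbhd H v) <=
    (@game_value G q (D :|: @closed_nbhd G v)).+2.
  move=> Dv; have [eqN|[y def_e eqN]] := closed_nbhd_del_edge v.
    by rewrite -eqN; apply: IH; apply: legal_proper.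
  have eD : e \subset D :|: @closed_nbhd G v.
    by rewrite def_e subUset !sub1set eqN !inE !eqxx !orbT.
  (* The rest of the game on [G] is a game on [H] with [y] predominated. The loss of two is incurred
     here alone, without the induction hypothesis. *)
  rewrite -(game_value_del_edge q eD) eqN setUCA.
  exact: (@game_value_predominate H q (D :|: @closed_nbhd H v) y).
case: p.
  have [->|nD] := eqVneq D setT; first by rewrite (@game_value_setT H).
  have [v Dv ->] := @game_value_Dominator_attained G D nD.
  apply: leq_trans (@game_value_Dominator_le_any H D v) _.
  by rewrite ltnS; apply: step.
apply: (@game_value_Staller_leP H) => v Dv'.
(* In this direction every Staller move can be copied, since closed neighborhoods only grow from [H]
   to [G]. *)
have Dv : @legal G D v.
  by apply: contra Dv'; apply: subset_trans; apply: closed_nbhd_del_edge_sub.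
apply: leq_ltn_trans (step _ _ Dv) _; rewrite !ltnS.
exact: game_value_Staller_ge.
Qed.

End EdgeRemoval.

Import Order.TTheory GRing.Theory Num.Theory.

Lemma distz_le2 (m n : nat) : m <= n.+2 -> n <= m.+2 -> (`|m%:Z - n%:Z| <= 2)%R.
Proof.
by move=> mn nm; rewrite ler_norml lerBrDl !lerBlDl -!PoszD !lez_nat addnC addn2 addn2 nm.
Qed.

Local Open Scope ring_scope.

Theorem theorem2p1 (G : sgraph) (e : {set G}) (he : e \in edges G) :
  `|(game_dom G)%:Z - (game_dom (del_edge e))%:Z| <= 2 /\
  `|(staller_game_dom G)%:Z - (staller_game_dom (del_edge e))%:Z| <= 2.
Proof.
(* Both games start from [set0], a position common to the two graphs. *)
by split; apply: distz_le2;
  [exact: game_value_le_del_edge | exact: game_value_del_edge_le |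
   exact: game_value_le_del_edge | exact: game_value_del_edge_le].
Qed.
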